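(* Let $d\ge 1$ and let $X=(X_i)_{i\in\mathbb{Z}^d}$ be a real-valued, mean zero, variance one, translation invariant random field with covariance $\mathbf{E}[X_iX_j]=K(i-j)$, where $(K(j))_{j\in\mathbb{Z}^d}\in\ell_1(\mathbb{Z}^d)$, and let $S(x)=\sum_{j\in\mathbb{Z}^d}e^{ix\cdot j}K(j)$, $x\in[-\pi,\pi]^d$, be its structure function. Let $\alpha_1,\ldots,\alpha_d\in[0,1]$. Suppose: (C1) There exist $\delta>0$ and constants $c_1,c_2>0$ such that for every $k\in\{1,\ldots,d\}$ and all $1\le i_1<\cdots<i_k\le d$, $$c_1|x_{i_1}|^{\alpha_{i_1}}\cdots|x_{i_k}|^{\alpha_{i_k}}\le S(x)\le c_2|x_{i_1}|^{\alpha_{i_1}}\cdots|x_{i_k}|^{\alpha_{i_k}}$$ for all $x\in[-\pi,\pi]^d$ such that, for each $i\in\{1,\ldots,d\}$, $|x_i|<\delta$ if and only if $i\in\{i_1,\ldots,i_k\}$. (C2) For every $\delta>0$, $\displaystyle\int_{\delta}^{\pi}\cdots\int_{\delta}^{\pi}\frac{S(x)}{x_1^2\cdots x_d^2}\,dx_1\cdots dx_d<\infty$. Then $$\operatorname{Var}(Q_{\mathcal{C}_L}(X))=\Theta\left((\log L)^{\tau_d}L^{d-m_d}\right)\quad\text{as }L\to\infty,$$ where $\tau_d=|\{k\in\{1,\ldots,d\}:\alpha_k=1\}|$ and $m_d=\sum_{k=1}^d\alpha_k$.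
   Context: $\mathcal{C}_L=[0,L]^d\subset\mathbb{R}^d$, and for bounded $\Lambda\subset\mathbb{R}^d$, $Q_\Lambda(X)=\sum_{i\in\Lambda\cap\mathbb{Z}^d}X_i$. $f(L)=\Theta(g(L))$ as $L\to\infty$ means that there exist constants $c_1,c_2,L_0>0$ with $c_1g(L)\le f(L)\le c_2g(L)$ for all $L>L_0$. The constants may depend on $d$. *)

(* Defs.v *)
From HB Require Import structures.
From mathcomp Require Export all_boot all_order all_algebra.
From mathcomp Require Export all_classical all_reals all_analysis.
From mathcomp Require Export complex.
From mathcomp.analysis.showcase Require summability.

Set Implicit Arguments.
Unset Strict Implicit.
Unset Printing Implicit Defensive.

Import Order.TTheory GRing.Theory Num.Theory.
Import numFieldNormedType.Exports.

Local Open Scope classical_set_scope.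
Local Open Scope ring_scope.

Definition cylinder {R : realType} {I : Type} : set (set (I -> R)) :=
  [set C | exists i (B : set R), measurable B /\ C = [set f | B (f i)]].

(* Invariance in law: the push-forward of P under the field and under each of
   its shifts agree on the product sigma-algebra of R^(Z^d). *)
Definition translation_invariant {disp : measure_display}
    {T : measurableType disp} {R : realType} (P : probability T R) {d : nat}
    (X : 'rV[int]_d -> T -> R) : Prop :=
  forall (v : 'rV[int]_d) (A : set ('rV[int]_d -> R)), <<s cylinder >> A ->
    P [set w | A (fun i => X (i + v) w)] = P [set w | A (fun i => X i w)].

Definition cube (R : realType) (d : nat) (a b : R) : set 'rV[R]_d :=
  [set x | forall k, a <= x 0 k <= b].

(* The support restriction of \sum_(i \in _) is harmless for bounded Lambda,
   which contains finitely many lattice points. *)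
Definition Q {T : Type} {R : realType} {d : nat} (Lambda : set 'rV[R]_d)
    (X : 'rV[int]_d -> T -> R) (w : T) : R :=
  \sum_(i \in [set i : 'rV[int]_d | Lambda (map_mx intr i)]) X i w.

Definition expi {R : realType} (t : R) : R[i] := (cos t +i* sin t)%C.

(* Unconditional sum over Z^d, i.e. the limit in R[i] of the finite partial sums
   along the directed set of finite subsets. *)
Definition structure_functionC {R : realType} {d : nat}
    (K : 'rV[int]_d -> R) (x : 'rV[R]_d) : R[i] :=
  @summability.sum _ R[i] R[i]^o
    (fun j : 'rV[int]_d => expi (\sum_k x 0 k * (j 0 k)%:~R) * ((K j)%:C)%C).

(* A covariance satisfies K (- j) = K j, so that for summable K the sum above is
   real; taking the real part only changes its type. *)
Definition structure_function {R : realType} {d : nat}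
    (K : 'rV[int]_d -> R) (x : 'rV[R]_d) : R :=
  complex.Re (structure_functionC K x).

(* The integral of f over D x ... x D (n factors) as an iterated integral. *)
Fixpoint iterated_integral {R : realType} (n : nat) (D : set R) :
    ('rV[R]_n -> \bar R) -> \bar R :=
  match n with
  | 0 => fun f => f 0
  | m.+1 => fun f => (\int[@lebesgue_measure R]_(t in D)
      iterated_integral D (fun y : 'rV[R]_m => f (row_mx (t%:M : 'rV_1) y)))%E
  end.

(* The sets I range over the nonempty index sets {i_1 < ... < i_k}; powR
   satisfies 0 `^ 0 = 1. *)
Definition power_behaviour {R : realType} {d : nat}
    (S : 'rV[R]_d -> R) (alpha : 'I_d -> R) : Prop :=
  exists delta c1 c2 : R, [/\ 0 < delta, 0 < c1, 0 < c2 &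
    forall I : {set 'I_d}, I != finset.set0 ->
    forall x, cube (- pi) pi x ->
      (forall i, `|x 0 i| < delta <-> i \in I) ->
      c1 * \prod_(i in I) `|x 0 i| `^ alpha i <= S x
        <= c2 * \prod_(i in I) `|x 0 i| `^ alpha i].

Definition off_axes_integrable {R : realType} {d : nat}
    (S : 'rV[R]_d -> R) : Prop :=
  forall delta : R, 0 < delta ->
    (iterated_integral `[delta, pi]%classic
       (fun x : 'rV[R]_d => (S x / \prod_i x 0 i ^+ 2)%:E) < +oo)%E.

Definition Theta {R : realType} (f : R -> \bar R) (g : R -> R) : Prop :=
  exists c1 c2 L0 : R, [/\ 0 < c1, 0 < c2, 0 < L0 &
    forall L, L0 < L -> ((c1 * g L)%:E <= f L <= (c2 * g L)%:E)%E].

(* Main.v *)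
(* Expanding the square, Var Q is the sum of K(b - a) over the pairs of lattice
   points a, b of the box {0, ..., n - 1}^d, n = floor L + 1, that is, the mean over
   [-pi, pi]^d of S(x) F_n(x_1) ... F_n(x_d) for the Fejer-type kernel
   F_n(x) = |sum_(s < n) e^(isx)|^2 = (2 - 2 cos nx) / (2 - 2 cos x).
   Instead of integrating, we average over the grid of 2np equally spaced points per
   coordinate: after truncating K to a finite set the discrete average is exact for
   p large, and the truncation error is at most 1.  S is bounded, so C1 gives
   S(x) <= C |x_1|^a_1 ... |x_d|^a_d on the whole cube, with a matching lower bound
   near 0 and a bounded contribution far from the axes.  The averages then factor
   into one-dimensional ones; F_n(x) is of order min(n^2, 1/x^2), so on
   [pi q / n, pi (q + 1) / n] the average of F_n(x) |x|^a is of order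
   n^(2 - a) (q + 1)^(a - 2), and summing over q < n gives n^(1 - a), with an extra
   factor log n when a = 1. *)
From mathcomp Require Import finmap ring lra zify.
Require Import Defs.

Set Implicit Arguments.
Unset Strict Implicit.
Unset Printing Implicit Defensive.

Import Order.TTheory GRing.Theory Num.Theory.
Import numFieldNormedType.Exports.

Local Open Scope classical_set_scope.
Local Open Scope ring_scope.

(** * The Fejer kernel *)

Lemma sin_mean_value (R : realType) (x : R) : 0 <= x ->
  exists2 c, 0 <= c <= x & sin x = cos c * x.
Proof.
move=> x0.
have cs : {within `[0, x], continuous (@sin R)}.
  exact/continuous_subspaceT/continuous_sin.
have [c cx e] := MVT_segment x0 (fun y _ => is_derive_sin y) cs.
by exists c => //; move: e; rewrite sin0 !subr0.
Qed.

Lemma sin_le_id (R : realType) (x : R) : 0 <= x -> sin x <= x.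
Proof.
move=> x0; have [c _ ->] := sin_mean_value x0.
by rewrite ler_piMl ?cos_le1.
Qed.

Lemma norm_sin_le (R : realType) (x : R) : `|sin x| <= `|x|.
Proof.
wlog x0 : x / 0 <= x.
  move=> h; have [/h//|/ltW] := leP 0 x; rewrite -oppr_ge0 => /h.
  by rewrite sinN !normrN.
rewrite (ger0_norm x0); have [s0|s0] := leP 0 (sin x).
  by rewrite ger0_norm// sin_le_id.
have [x1|x1] := leP 1 x; first by rewrite (le_trans (sin_max x)).
have : 0 <= sin x by rewrite sin_ge0_pi// x0 (le_trans (ltW x1))// (le_trans _ (@pi_ge2 R))// ler1n.
by rewrite leNgt s0.
Qed.

Lemma norm_sin_ge (R : realType) : exists2 k : R, 0 < k &
  forall x, `|x| <= pi / 2 -> k * `|x| <= `|sin x|.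
Proof.
have c1 := @cos1_gt0 R.
have s1 : 0 < sin (1 : R) by rewrite sin2_gt0// ltr01 ltr1n.
(* On [0, 1] the mean value theorem gives sin x = x cos c with cos c >= cos 1. On [1, pi/2], sin x
   >= sin 1, and x / 2 <= 1 there. *)
exists (Num.min (cos 1) (sin 1 / 2)); first by rewrite lt_min c1 divr_gt0.
set k := Num.min _ _.
have k0 : 0 <= k by rewrite le_min ltW//= divr_ge0// ltW.
move=> x; wlog x0 : x / 0 <= x.
  move=> h; have [/h//|/ltW] := leP 0 x; rewrite -oppr_ge0 => /h.
  by rewrite sinN !normrN.
rewrite (ger0_norm x0) => x2; have pi2 := @pihalf_lt2 R; have pi1 := @pihalf_ge1 R.
apply: le_trans (ler_norm _).
have [x1|x1] := leP x 1.
  have [c /andP[c0 cx] ->] := sin_mean_value x0.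
  rewrite ler_wpM2r// (@le_trans _ _ (cos 1))//; first by rewrite ge_min lexx.
  have c1' : c <= 1 by lra.
  move: c1'; rewrite le_eqVlt => /orP[/eqP ->//|c1'].
  rewrite ltW// ltr_cos//.
    rewrite in_itv/= c0/=; lra.
  rewrite in_itv/= ler01/=; lra.
have : sin 1 <= sin x.
  rewrite ltW// ltr_sin// in_itv/=; lra.
apply: le_trans; rewrite (@le_trans _ _ (sin 1 / 2 * x))//.
  by rewrite ler_wpM2r// ge_min lexx orbT.
by rewrite -mulrA ler_piMr ?(ltW s1)// mulrC ler_pdivrMr// mul1r; lra.
Qed.

Lemma two_sub_cos (R : realType) (x : R) : 2 - 2 * cos x = 4 * sin (x / 2) ^+ 2.
Proof.
have -> : cos x = cos (x / 2 + x / 2) by congr cos; field.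
rewrite cosD; have := cos2Dsin2 (x / 2); rewrite !expr2; lra.
Qed.

Lemma two_sub_cos_le (R : realType) (x : R) : 2 - 2 * cos x <= x ^+ 2.
Proof.
rewrite two_sub_cos.
have := norm_sin_le (x / 2); rewrite -(@ler_pXn2r _ 2) ?nnegrE// !real_normK ?num_real//.
rewrite !expr2; lra.
Qed.

Lemma two_sub_cos_ge (R : realType) : exists2 k : R, 0 < k &
  forall x : R, `|x| <= pi -> k * x ^+ 2 <= 2 - 2 * cos x.
Proof.
have [k k0 kP] := norm_sin_ge R; exists (k ^+ 2); first exact: exprn_gt0.
move=> x xpi; rewrite two_sub_cos.
have : k * `|x / 2| <= `|sin (x / 2)|.
  by apply: kP; rewrite normrM (ger0_norm (_ : 0 <= 2^-1))// ler_wpM2r.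
rewrite -(@ler_pXn2r _ 2) ?nnegrE// ?mulr_ge0// ?(ltW k0)// exprMn !real_normK ?num_real//.
rewrite exprMn !expr2; lra.
Qed.

(** This is n times the usual normalised Fejer kernel. In the double-sum form evenness and the bound
    n^2 hold termwise; nonnegativity comes from [fejerE]. *)
Definition fejer {R : realType} (n : nat) (x : R) : R :=
  \sum_(s < n) \sum_(t < n) cos (x * (s%:R - t%:R)).

Section fejer.
Variable R : realType.
Implicit Types (n : nat) (x : R).

Lemma fejerE n x :
  fejer n x = (\sum_(s < n) cos (x * s%:R)) ^+ 2 + (\sum_(s < n) sin (x * s%:R)) ^+ 2.
Proof.
rewrite !expr2 !big_distrl -big_split/=; apply: eq_bigr => s _.
rewrite !big_distrr -big_split/=; apply: eq_bigr => t _.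
by rewrite mulrBr cosB.
Qed.

Lemma fejer_ge0 n x : 0 <= fejer n x.
Proof. by rewrite fejerE addr_ge0// sqr_ge0. Qed.

Lemma fejerN n x : fejer n (- x) = fejer n x.
Proof. by do 2 apply: eq_bigr => ? _; rewrite mulNr cosN. Qed.

Lemma fejer_le n x : fejer n x <= n%:R ^+ 2.
Proof.
rewrite expr2 /fejer.
have -> : n%:R * n%:R = \sum_(s < n) \sum_(t < n) (1 : R).
  by rewrite !sumr_const !card_ord mulr_natr.
by apply: ler_sum => s _; apply: ler_sum => t _; exact: cos_le1.
Qed.

(** The terms telescope by 2 cos (u + t/2) sin (t/2) = sin (u + t) - sin u. The offset [m0] lets the
    sum run over any block of midpoints. *)
Lemma sum_cos_telescope (m0 m : nat) (t : R) :
  (\sum_(j < m) 2 * cos ((m0 + j)%:R * t + t / 2)) * sin (t / 2)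
  = sin ((m0 + m)%:R * t) - sin (m0%:R * t).
Proof.
elim: m => [|m IH]; first by rewrite big_ord0 mul0r addn0 subrr.
rewrite big_ord_recr/= mulrDl IH addnS.
have -> : (m0 + m).+1%:R * t = ((m0 + m)%:R * t + t / 2) + t / 2.
  by rewrite -natr1; field.
set u := (m0 + m)%:R * t.
have -> : sin u = sin ((u + t / 2) - t / 2) by congr sin; field.
rewrite (sinB (u + t / 2)) (sinD (u + t / 2)); ring.
Qed.

(** Multiplied by 2 sin (x/2), the cosine and sine sums have closed forms whose squares add up to
    the right-hand side. The product form stays valid where 2 - 2 cos x vanishes. *)
Lemma fejer_sum_sq n x :
  fejer n x * (2 - 2 * cos x) = 2 - 2 * cos (n%:R * x).
Proof.
have C : (\sum_(s < n) cos (x * s%:R)) * (2 * sin (x / 2))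
    = sin (n%:R * x - x / 2) + sin (x / 2).
  elim: n => [|n IH]; first by rewrite big_ord0 mul0r mul0r sub0r sinN addNr.
  rewrite big_ord_recr/= mulrDl IH -(natr1 n).
  have -> : (n%:R + 1) * x - x / 2 = n%:R * x + x / 2 by field.
  rewrite (mulrC x n%:R) (sinD _ (x / 2)) (sinB _ (x / 2)); ring.
have S : (\sum_(s < n) sin (x * s%:R)) * (2 * sin (x / 2))
    = cos (x / 2) - cos (n%:R * x - x / 2).
  elim: n {C} => [|n IH]; first by rewrite big_ord0 mul0r mul0r sub0r cosN subrr.
  rewrite big_ord_recr/= mulrDl IH -(natr1 n).
  have -> : (n%:R + 1) * x - x / 2 = n%:R * x + x / 2 by field.
  rewrite (mulrC x n%:R) (cosD _ (x / 2)) (cosB _ (x / 2)); ring.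
rewrite two_sub_cos fejerE.
transitivity (((\sum_(s < n) cos (x * s%:R)) * (2 * sin (x / 2))) ^+ 2 +
  ((\sum_(s < n) sin (x * s%:R)) * (2 * sin (x / 2))) ^+ 2); first by ring.
rewrite C S.
have -> : cos (n%:R * x) = cos ((n%:R * x - x / 2) + x / 2) by congr cos; field.
rewrite (cosD _ (x / 2)); set a := n%:R * x - x / 2; set b := x / 2.
transitivity ((cos a ^+ 2 + sin a ^+ 2) + (cos b ^+ 2 + sin b ^+ 2)
  - 2 * (cos a * cos b - sin a * sin b)); first by ring.
by rewrite !cos2Dsin2.
Qed.

(** The oscillating numerator is kept: it can vanish, so a lower bound of order 1/x^2 is recovered
    only after averaging over a block. *)
Lemma fejer_ge_sqr n x : x != 0 ->
  (2 - 2 * cos (n%:R * x)) / x ^+ 2 <= fejer n x.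
Proof.
move=> x0; rewrite ler_pdivrMr ?exprn_even_gt0// -fejer_sum_sq.
by rewrite ler_wpM2l ?fejer_ge0// two_sub_cos_le.
Qed.

Lemma fejer_le_sqr : exists2 k : R, 0 < k &
  forall n x, `|x| <= pi -> x != 0 -> fejer n x <= k / x ^+ 2.
Proof.
have [k k0 kP] := two_sub_cos_ge R; exists (4 / k); first by rewrite divr_gt0.
move=> n x xpi x0; rewrite ler_pdivlMr ?exprn_even_gt0// ler_pdivlMr//.
have : fejer n x * (k * x ^+ 2) <= fejer n x * (2 - 2 * cos x).
  by rewrite ler_wpM2l ?fejer_ge0 ?kP.
rewrite fejer_sum_sq; have := cos_geN1 (n%:R * x); lra.
Qed.

End fejer.

(** * The structure function as a uniform limit *)

Lemma esum_fset_le (R : realType) (I : choiceType) (a : I -> R) (J : {fset I}) :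
  ((\sum_(j <- J) a j)%:E <= \esum_(j in [set: I]) (a j)%:E)%E.
Proof.
apply: esum_ge; exists [set` J]; first by split=> //; exact: finite_fset.
by rewrite -fsbig_seq ?fset_uniq// sumEFin.
Qed.

(** A finite set whose sum comes within e of the supremum leaves at most e for any finite set
    disjoint from it. *)
Lemma summable_tail (R : realType) (I : choiceType) (K : I -> R) :
  esum.summable [set: I] (fun j => (K j)%:E) -> forall e : R, 0 < e ->
  exists J0 : {fset I}, forall J : {fset I}, (J0 `<=` J)%fset ->
    \sum_(j <- (J `\` J0)%fset) `|K j| <= e.
Proof.
rewrite summableE => sK e e0.
have /= := ub_ereal_sup_adherent e0 sK.
case=> _ [A [finA _] <-].
rewrite fsbig_finite//= sumEFin -/(esum _ _).
set s := esum _ _ in sK *.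
move=> lts; exists (fset_set A) => J AJ.
have := esum_fset_le (fun j => `|K j|) J.
rewrite -[X in (_ <= X)%E -> _]/s (big_fsetID _ (mem (fset_set A)))/=.
rewrite (_ : [fset x in J | x \in fset_set A]%fset = fset_set A); last first.
  apply/fsetP => x; rewrite !inE/= andbC.
  by case: (boolP (x \in fset_set A)) => //= /(fsubsetP AJ) ->.
rewrite (_ : [fset x in J | x \notin fset_set A]%fset
   = (J `\` fset_set A)%fset); last first.
  by apply/fsetP => x; rewrite !inE/= andbC.
move: lts; rewrite -(fineK sK) -EFinB lte_fin lee_fin => lts les; lra.
Qed.

Lemma summable_bound (R : realType) (I : choiceType) (K : I -> R) :
  esum.summable [set: I] (fun j => (K j)%:E) ->
  exists B : R, forall J : {fset I}, \sum_(j <- J) `|K j| <= B.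
Proof.
rewrite summableE => sK; exists (fine (\esum_(x in [set: I]) `|(K x)%:E|)%E) => J.
rewrite -lee_fin fineK//; exact: (esum_fset_le (fun j => `|K j|) J).
Qed.

(** The hypothesis on [J0] mentions [K] only, so one finite set serves every dominated family, in
    particular the cosine sums at all x. *)
Lemma dominated_fsum_dist (R : realType) (I : choiceType) (K f : I -> R)
    (fK : forall j, `|f j| <= `|K j|) (e : R) (J0 : {fset I}) :
  (forall J : {fset I}, (J0 `<=` J)%fset ->
    \sum_(j <- (J `\` J0)%fset) `|K j| <= e) ->
  forall J : {fset I}, (J0 `<=` J)%fset ->
    `|\sum_(j <- J) f j - \sum_(j <- J0) f j| <= e.
Proof.
move=> tl J J0J; rewrite [in X in X - _](big_fsetID _ (mem J0))/=.
rewrite (_ : [fset x in J | x \in J0]%fset = J0); last first.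
  apply/fsetP => x; rewrite !inE/= andbC.
  by case: (boolP (x \in J0)) => //= /(fsubsetP J0J) ->.
rewrite (_ : [fset x in J | x \notin J0]%fset = (J `\` J0)%fset); last first.
  by apply/fsetP => x; rewrite !inE/= andbC.
rewrite addrAC subrr add0r (le_trans (ler_norm_sum _ _ _))//.
by rewrite (le_trans _ (tl _ J0J))// ler_sum.
Qed.

Lemma dominated_fsum_cvg (R : realType) (I : choiceType) (K f : I -> R) :
  esum.summable [set: I] (fun j => (K j)%:E) ->
  (forall j, `|f j| <= `|K j|) ->
  exists l : R, summability.partial_sum f @ summability.totally --> l.
Proof.
move=> sK fK; have FF := @summability.totally_filter I.
suff : cvg (summability.partial_sum f @ summability.totally).
  by move=> cf; exists (lim (summability.partial_sum f @ summability.totally)).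
apply/cauchy_cvgP/cauchy_exP => e e0.
have [J0 J0P] := summable_tail sK (divr_gt0 e0 (@ltr0n R 2)).
exists (\sum_(j <- J0) f j); exists J0 => //= J J0J.
rewrite -ball_normE/= distrC /summability.partial_sum -[X in `|X - _|](big_seq_fsetE _ _ predT f)/=.
rewrite (le_lt_trans (dominated_fsum_dist fK J0P J0J))//; lra.
Qed.

Lemma normc_le_Re_Im (R : realType) (z : R[i]) :
  `|z| <= (`|complex.Re z| + `|complex.Im z|)%:C%C.
Proof.
rewrite normc_def lecR -[leRHS]ger0_norm ?addr_ge0// -sqrtr_sqr.
rewrite ler_wsqrtr// sqrrD !real_normK ?num_real// lerD2r lerDl.
by rewrite mulrn_wge0// mulr_ge0.
Qed.

Lemma Re_sum (R : realType) (J : Type) (s : seq J) (F : J -> R[i]) :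
  complex.Re (\sum_(j <- s) F j) = \sum_(j <- s) complex.Re (F j).
Proof. by apply: (big_morph (@complex.Re R)) => // -[? ?] [? ?]. Qed.

Lemma Im_sum (R : realType) (J : Type) (s : seq J) (F : J -> R[i]) :
  complex.Im (\sum_(j <- s) F j) = \sum_(j <- s) complex.Im (F j).
Proof. by apply: (big_morph (@complex.Im R)) => // -[? ?] [? ?]. Qed.

(** The real parts of the partial sums of [structure_functionC], as K is real. *)
Definition structure_partial {R : realType} {d : nat} (K : 'rV[int]_d -> R)
    (J : {fset 'rV[int]_d}) (x : 'rV[R]_d) : R :=
  \sum_(j <- J) K j * cos (\sum_k x 0 k * (j 0 k)%:~R).

(** The limit in the definition is taken in R[i], so the sine sums must converge as well: the
    complex partial sums then tend to a + i b, whose real part is a. *)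
Lemma structure_function_cvg (R : realType) (d : nat) (K : 'rV[int]_d -> R)
    (x : 'rV[R]_d) :
  esum.summable [set: 'rV[int]_d] (fun j => (K j)%:E) ->
  structure_partial K ^~ x @ summability.totally --> structure_function K x.
Proof.
move=> sK; have FF := @summability.totally_filter 'rV[int]_d.
pose y (j : 'rV[int]_d) := \sum_k x 0 k * (j 0 k)%:~R.
have Ktrig (g : R -> R) : (forall t, `|g t| <= 1) -> forall j, `|K j * g (y j)| <= `|K j|.
  by move=> g1 j; rewrite normrM ler_piMr.
have [a ca] := dominated_fsum_cvg sK (Ktrig _ (@cos_max R)).
have [b cb] := dominated_fsum_cvg sK (Ktrig _ (@sin_max R)).
have Eps (f : 'rV[int]_d -> R) : summability.partial_sum f = fun J : {fset 'rV[int]_d} => \sum_(j <- J) f j.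
  by apply/funext => J; rewrite /summability.partial_sum -(big_seq_fsetE _ _ predT f).
rewrite !Eps in ca cb.
suff -> : structure_function K x = a by [].
rewrite /structure_function /structure_functionC /summability.sum.
rewrite (_ : lim _ = ((a +i* b)%C : R[i]^o))//.
apply: (@cvg_lim R[i]^o (@norm_hausdorff _ R[i]^o)).
apply/cvgrPdist_le => e e0.
(* A positive element of R[i] is real, so the complex tolerance is a real one. *)
have [e1 e1E] : exists e1 : R, e = (e1%:C)%C.
  by exists (complex.Re e); rewrite RRe_real// gtr0_real.
have e10 : 0 < e1 by move: e0; rewrite e1E ltcR.
have e20 : 0 < e1 / 2 by rewrite divr_gt0.
move/cvgrPdist_le : ca => /(_ _ e20) ca.
move/cvgrPdist_le : cb => /(_ _ e20) cb.
near=> J.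
rewrite /summability.partial_sum.
rewrite -(big_seq_fsetE _ _ predT (fun j => expi (y j) * ((K j)%:C)%C))/=.
apply: (le_trans (normc_le_Re_Im _)).
rewrite e1E lecR !raddfB/= Re_sum Im_sum/=.
rewrite [e1]splitr lerD//.
  rewrite (eq_bigr (fun j => K j * cos (y j))); last first.
    by move=> j _ /=; rewrite mulr0 subr0 mulrC.
  near: J; exact: ca.
rewrite (eq_bigr (fun j => K j * sin (y j))); last first.
  by move=> j _ /=; rewrite mulr0 add0r mulrC.
near: J; exact: cb.
Unshelve. all: by end_near.
Qed.

Lemma structure_function_approx (R : realType) (d : nat) (K : 'rV[int]_d -> R) :
  esum.summable [set: 'rV[int]_d] (fun j => (K j)%:E) ->
  forall e : R, 0 < e -> exists J0 : {fset 'rV[int]_d},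
  forall J : {fset 'rV[int]_d}, (J0 `<=` J)%fset ->
  forall x, `|structure_function K x - structure_partial K J x| <= e.
Proof.
move=> sK e e0; have FF := @summability.totally_filter 'rV[int]_d.
have e20 : 0 < e / 2 by rewrite divr_gt0.
have [J0 J0P] := summable_tail sK e20.
exists J0 => J J0J x.
have fK (j : 'rV[int]_d) : `|K j * cos (\sum_k x 0 k * (j 0 k)%:~R)| <= `|K j|.
  by rewrite normrM ler_piMr// cos_max.
have close := dominated_fsum_dist fK J0P.
(* Partial sums beyond [J0] and the one over [J] are all within e / 2 of the one over [J0]. Hence
   the former lie in a closed ball of radius e, and so does their limit. *)
have : closed_ball_ [eta Num.norm] (structure_partial K J x) e (structure_function K x).
  apply: (@closed_cvg _ _ _ FF (structure_partial K ^~ x)); last exact: structure_function_cvg.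
    exact: closed_closed_ball_.
  exists J0 => //= J' J0J'.
  have := close _ J0J; have := close _ J0J'.
  rewrite -!/(structure_partial K _ x) /closed_ball_/= !ler_norml.
  by move=> /andP[? ?] /andP[? ?]; apply/andP; split; lra.
by rewrite /closed_ball_/= distrC.
Qed.

Lemma structure_function_bounded (R : realType) (d : nat) (K : 'rV[int]_d -> R) :
  esum.summable [set: 'rV[int]_d] (fun j => (K j)%:E) ->
  exists B : R, forall x, `|structure_function K x| <= B.
Proof.
move=> sK; have [B BP] := summable_bound sK.
have [J0 /(_ J0 (fsubset_refl _)) J0P] := structure_function_approx sK ltr01.
exists (B + 1) => x.
have : `|structure_partial K J0 x| <= B.
  rewrite (le_trans (ler_norm_sum _ _ _))// (le_trans _ (BP J0))// ler_sum// => j _.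
  by rewrite normrM ler_piMr// cos_max.
have := J0P x; rewrite !ler_norml.
by move=> /andP[? ?] /andP[? ?]; apply/andP; split; lra.
Qed.

(** * The variance over a box *)

Section covariance_of_sums.
Context {disp : measure_display} {T : measurableType disp} {R : realType}.
Variable P : probability T R.

Lemma covariance_suml (I : Type) (s : seq I) (Y : I -> T -> R) (Z : T -> R) :
  (forall i, Y i \in Lfun P 2%:E) -> Z \in Lfun P 2%:E ->
  (covariance P (fun w => \sum_(i <- s) Y i w)%R Z
   = \sum_(i <- s) covariance P (Y i) Z)%E.
Proof.
move=> Y2 Z2; elim: s => [|i s IH].
  by rewrite big_nil -(covariance_cst_l P 0 Z); congr covariance;
    apply/funext => w; rewrite big_nil.
rewrite big_cons -IH -covarianceDl//; last first.
  rewrite (_ : (fun w => _) = \sum_(j <- s) Y j); last first.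
    by apply/funext => w; rewrite fct_sumE.
  by rewrite rpred_sum// lee_fin ler1n.
by congr covariance; apply/funext => w; rewrite big_cons.
Qed.

Lemma variance_sum (I : finType) (Y : I -> T -> R) :
  (forall i, Y i \in Lfun P 2%:E) ->
  ('V_P[fun w => \sum_i Y i w]%R = \sum_i \sum_j covariance P (Y i) (Y j))%E.
Proof.
move=> Y2; rewrite /variance covariance_suml//; last first.
  rewrite (_ : (fun w => _) = \sum_j Y j); last first.
    by apply/funext => w; rewrite fct_sumE.
  by rewrite rpred_sum// lee_fin ler1n.
apply: eq_bigr => i _; rewrite covarianceC covariance_suml//.
by apply: eq_bigr => j _; rewrite covarianceC.
Qed.

(** As the mean is 0, the variance is the integral of X^2, and its finiteness is square
    integrability. *)
Lemma centered_Lfun2 (X : {RV P >-> R}) (v : R) :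
  ('E_P[X] = 0)%E -> ('V_P[X] = v%:E)%E -> (X : T -> R) \in Lfun P 2%:E.
Proof.
move=> X0 XV; rewrite inE; apply/andP; split; first by rewrite inE/=.
have := XV; rewrite /variance unlock X0/= => X2.
rewrite inE/= /finite_norm unlock /=.
rewrite poweR_lty//.
rewrite (_ : (\int[P]_x _)%E = 'E_P[((X \- cst 0) * (X \- cst 0))%R])%E; last first.
  rewrite unlock; apply: eq_integral => w _ /=.
  rewrite powR_mulrn// real_normK ?num_real//.
  by rewrite expr2 -[in LHS](subr0 (X w)).
by rewrite X2 ltry.
Qed.

Lemma variance_sum_centered (I : finType) (Y : I -> {RV P >-> R}) (v : I -> R)
    (c : I -> I -> R) :
  (forall i, 'E_P[Y i] = 0)%E -> (forall i, 'V_P[Y i] = (v i)%:E)%E ->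
  (forall i j, 'E_P[(Y i : T -> R) \* Y j] = (c i j)%:E)%E ->
  ('V_P[fun w => \sum_i Y i w]%R = (\sum_i \sum_j c i j)%:E)%E.
Proof.
move=> Y0 Yv Yc; have Y2 i := centered_Lfun2 (Y0 i) (Yv i).
have Pfin : P [set: T] \is a fin_num := fin_num_measure P _ measurableT.
rewrite (variance_sum Y2) -sumEFin; apply: eq_bigr => i _.
rewrite -sumEFin; apply: eq_bigr => j _.
rewrite covarianceE.
- by rewrite !Y0 mul0e sube0 -Yc.
- exact: (Lfun_subset12 Pfin).
- exact: (Lfun_subset12 Pfin).
- exact: Lfun2_mul_Lfun1.
Qed.

End covariance_of_sums.

(** * Lattice points of the cube *)

Definition lattice_point {d n : nat} (a : {ffun 'I_d -> 'I_n}) : 'rV[int]_d :=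
  \row_k (a k : nat)%:Z.

Lemma lattice_point_inj (d n : nat) : injective (@lattice_point d n).
Proof.
move=> a b /rowP ab; apply/ffunP => k; apply/val_inj.
by have := ab k; rewrite !mxE => -[].
Qed.

(** A lattice point of [0, L]^d has its coordinates among 0, ..., floor L, which are floor L + 1
    values. *)
Lemma Q_cube (T : Type) (R : realType) (d : nat) (L : R)
    (X : 'rV[int]_d -> T -> R) : 0 <= L ->
  Q (cube 0 L) X = fun w => \sum_(a : {ffun 'I_d -> 'I_(Num.truncn L).+1})
                              X (lattice_point a) w.
Proof.
move=> L0; apply/funext => w; rewrite /Q.
transitivity (\sum_(i <- map lattice_point
    (enum {ffun 'I_d -> 'I_(Num.truncn L).+1})) X i w); last first.
  by rewrite big_map big_enum.
rewrite [RHS]fsbig_seq ?(map_inj_uniq (@lattice_point_inj _ _)) ?enum_uniq//.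
apply: eq_fsbigl; apply/seteqP; split => i /=.
  move=> iL.
  have ik k : exists m : 'I_(Num.truncn L).+1, i 0 k = (m : nat)%:Z.
    have := iL k; rewrite mxE ler0z => /andP[].
    case: (i 0 k) => // m _ mL.
    have mn : (m < (Num.truncn L).+1)%N by rewrite ltnS truncn_ge_nat.
    by exists (Ordinal mn).
  have [a aP] := choice ik.
  apply/mapP; exists [ffun k => a k]; first by rewrite mem_enum.
  by apply/rowP => k; rewrite mxE ffunE aP.
case/mapP => a _ -> k; rewrite !mxE/= ler0n/=.
by rewrite -truncn_ge_nat// -ltnS ltn_ord.
Qed.

Lemma variance_Q_cube (R : realType) (disp : measure_display)
    (T : measurableType disp) (P : probability T R) (d : nat)
    (X : 'rV[int]_d -> {RV P >-> R}) (K : 'rV[int]_d -> R) (L : R) :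
  (forall i, 'E_P[X i] = 0)%E -> (forall i, 'V_P[X i] = 1)%E ->
  (forall i j, 'E_P[X i \* X j] = (K (i - j))%:E)%E -> 0 <= L ->
  ('V_P[Q (cube 0 L) X] =
    (\sum_(a : {ffun 'I_d -> 'I_(Num.truncn L).+1}) \sum_(b : {ffun 'I_d -> 'I_(Num.truncn L).+1})
       K (lattice_point b - lattice_point a))%:E)%E.
Proof.
(* With the sums swapped, K (b - a) is the covariance of X_b and X_a with b as the outer index. *)
move=> X0 X1 XK L0; rewrite Q_cube// exchange_big.
exact: (variance_sum_centered (v := fun=> 1)).
Qed.

(** * Fourier orthogonality on a grid *)

Section grid.
Variable R : realType.

Lemma expiD (s t : R) : expi (s + t) = expi s * expi t.
Proof.
by apply/eqP; rewrite eq_complex/= cosD sinD eqxx/=; apply/eqP; ring.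
Qed.

Lemma expi0 : expi (0 : R) = 1.
Proof. by rewrite /expi cos0 sin0. Qed.

Lemma expi_sum (I : Type) (s : seq I) (f : I -> R) :
  expi (\sum_(i <- s) f i) = \prod_(i <- s) expi (f i).
Proof. exact: (big_morph (@expi R) expiD expi0). Qed.

Lemma sin_natpi (n : nat) : sin (n%:R * pi : R) = 0.
Proof.
elim: n => [|n IH]; first by rewrite mul0r sin0.
by rewrite -natr1 mulrDl mul1r sinDpi IH oppr0.
Qed.

(* The points +-midpoint n p q r are the centres of 2np equal subintervals of
   [-pi, pi].  They avoid 0, and for fixed q the p points midpoint n p q r lie in
   [pi q / n, pi (q + 1) / n], half a period of cos (n x). *)
Definition midpoint (n p : nat) (q r : nat) : R :=
  pi * (q * p + r).*2.+1%:R / (n * p).*2%:R.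

Definition grid (n p : nat) : finType := (bool * ('I_n * 'I_p))%type.

Definition gridpoint {n p : nat} (g : grid n p) : R :=
  (-1) ^+ g.1 * midpoint n p g.2.1 g.2.2.

Lemma midpoint_gt0 (n p : nat) (q : 'I_n) (r : 'I_p) : 0 < midpoint n p q r.
Proof.
have n0 : (0 < n)%N by case: n q => // -[].
have p0 : (0 < p)%N by case: p r => // -[].
by rewrite divr_gt0 ?mulr_gt0 ?pi_gt0 ?ltr0n ?double_gt0 ?muln_gt0 ?n0.
Qed.

Lemma midpoint_bounds (n p : nat) (q : 'I_n) (r : 'I_p) :
  pi * q%:R / n%:R <= midpoint n p q r < pi * q.+1%:R / n%:R.
Proof.
have n0 : (0 < n)%N by case: n q => // -[].
have p0 : (0 < p)%N by case: p r => // -[].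
have np0 : 0 < (n * p).*2%:R :> R by rewrite ltr0n double_gt0 muln_gt0 n0.
rewrite /midpoint ler_pdivlMr// ltr_pdivrMr//.
rewrite doubleMr natrM !mulrA !divfK ?pnatr_eq0 -?lt0n// -!mulrA -!natrM.
rewrite ler_pM2l ?pi_gt0// ltr_pM2l ?pi_gt0// ler_nat ltr_nat.
have rp := ltn_ord r; apply/andP; split; lia.
Qed.

Lemma midpoint_le_pi (n p : nat) (q : 'I_n) (r : 'I_p) : midpoint n p q r <= pi.
Proof.
have n0 : (0 < n)%N by case: n q => // -[].
have /andP[_ /ltW/le_trans] := midpoint_bounds q r; apply.
by rewrite -mulrA ler_piMr ?pi_ge0// ler_pdivrMr ?ltr0n// mul1r ler_nat.
Qed.

Lemma norm_gridpoint (n p : nat) (g : grid n p) :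
  `|gridpoint g| = midpoint n p g.2.1 g.2.2.
Proof. by rewrite normrM normr_sign mul1r ger0_norm// ltW// midpoint_gt0. Qed.

Lemma sum_grid (V : nmodType) (n p : nat) (F : R -> V) :
  \sum_(g : grid n p) F (gridpoint g) =
  \sum_(q < n) \sum_(r < p) (F (midpoint n p q r) + F (- midpoint n p q r)).
Proof.
rewrite -(pair_bigA _ (fun b i => F (gridpoint (b, i)))) big_bool/= addrC -big_split/=.
rewrite -(pair_bigA _ (fun q r => F (gridpoint (false, (q, r))) + F (gridpoint (true, (q, r)))))/=.
apply: eq_bigr => q _; apply: eq_bigr => r _.
by rewrite /gridpoint/= expr0 expr1 mul1r mulN1r.
Qed.

(** Multiplied by sin (t / 2), each block telescopes, and then so do the blocks, leaving sin (c pi)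
    = 0. The bounds on c place t / 2 = pi c / (2np) strictly between 0 and pi, so the factor can be
    cancelled. *)
Lemma sum_cos_midpoint (n p c : nat) : (0 < c < (n * p).*2)%N ->
  \sum_(q < n) \sum_(r < p) 2 * cos (midpoint n p q r * c%:R) = 0 :> R.
Proof.
move=> /andP[c0 cnp].
have np0 : (0 < n * p)%N by rewrite -double_gt0 (leq_trans _ cnp).
have npR : (n * p)%:R != 0 :> R by rewrite pnatr_eq0 -lt0n.
pose t : R := pi * c%:R / (n * p)%:R.
have s0 : sin (t / 2) != 0.
  rewrite gt_eqF// sin_gt0_pi// /t.
  rewrite !divr_gt0 ?mulr_gt0 ?pi_gt0 ?ltr0n//=.
  rewrite -mulrA -invfM -natrM muln2 ltr_pdivrMr ?ltr0n ?double_gt0//.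
  by rewrite ltr_pM2l ?pi_gt0// ltr_nat.
apply: (mulIf s0); rewrite mul0r big_distrl/=.
have E q : (\sum_(r < p) 2 * cos (midpoint n p q r * c%:R)) * sin (t / 2) =
    sin ((q.+1 * p)%:R * t) - sin ((q * p)%:R * t).
  rewrite mulSn addnC -sum_cos_telescope; congr (_ * _); apply: eq_bigr => r _.
  congr (2 * cos _); rewrite /midpoint /t -!muln2 -(natr1 ((q * p + r) * 2)) !natrM; field.
  by move: npR; rewrite natrM mulf_eq0 negb_or => /andP[-> ->].
under eq_bigr do rewrite E.
rewrite -(big_mkord xpredT (fun q => sin ((q.+1 * p)%:R * t) - sin ((q * p)%:R * t))).
rewrite (telescope_sumr (fun q => sin ((q * p)%:R * t)))// mul0n mul0r sin0 subr0.
rewrite (_ : _ * t = c%:R * pi) ?sin_natpi// /t.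
by rewrite mulrC divfK// mulrC.
Qed.

(** Opposite grid points cancel the imaginary parts and double the cosines; for c = 0 the points are
    merely counted. *)
Lemma sum_expi_grid (n p : nat) (c : int) : (`|c| < (n * p).*2)%N ->
  \sum_(g : grid n p) expi (gridpoint g * c%:~R) =
    (c == 0)%:R * (n * p).*2%:R :> R[i].
Proof.
move=> cnp; rewrite (sum_grid _ _ (fun x => expi (x * c%:~R))).
have -> : \sum_(q < n) \sum_(r < p) (expi (midpoint n p q r * c%:~R) +
      expi (- midpoint n p q r * c%:~R)) =
    ((\sum_(q < n) \sum_(r < p) 2 * cos (midpoint n p q r * `|c|%N%:R))%:C)%C.
  rewrite rmorph_sum; apply: eq_bigr => q _; rewrite rmorph_sum; apply: eq_bigr => r _.
  have -> : cos (midpoint n p q r * `|c|%N%:R) = cos (midpoint n p q r * c%:~R).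
    rewrite -[LHS]cos_norm -[RHS]cos_norm !normrM; congr (cos (_ * _)).
    by rewrite normr_nat natr_absz intr_norm.
  apply/eqP; rewrite eq_complex/= mulNr cosN sinN subrr eqxx andbT; apply/eqP; ring.
have [->|c0] := eqVneq c 0.
  rewrite mul1r absz0.
  under eq_bigr do under eq_bigr do rewrite mulr0 cos0 mulr1.
  by rewrite !sumr_const !card_ord -!mulrnA rmorph_nat; congr (_ *+ _); lia.
by rewrite sum_cos_midpoint ?absz_gt0 ?c0// mul0r.
Qed.

Definition gridvector {d n p : nat} (g : {ffun 'I_d -> grid n p}) : 'rV[R]_d :=
  \row_k gridpoint (g k).

(** The sum factors over the coordinates, and a single nonzero frequency annihilates the product. *)
Lemma sum_expi_gridvector (d n p : nat) (c : 'rV[int]_d) :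
  (forall k, (`|(c 0 k)%R| < (n * p).*2)%N) ->
  \sum_(g : {ffun 'I_d -> grid n p}) expi (\sum_k gridvector g 0 k * (c 0 k)%:~R)
  = (c == 0)%:R * (n * p).*2%:R ^+ d :> R[i].
Proof.
move=> cnp.
transitivity (\prod_k \sum_(g : grid n p) (expi (gridpoint g * (c 0 k)%:~R) : R[i])).
  rewrite bigA_distr_bigA; apply: eq_bigr => g _; rewrite expi_sum.
  by apply: eq_bigr => k _; rewrite mxE.
rewrite (eq_bigr (fun k => (c 0 k == 0)%:R * (n * p).*2%:R)); last first.
  by move=> k _; rewrite sum_expi_grid.
rewrite big_split/= prodr_const card_ord; congr (_ * _).
have [->|c0] := eqVneq c 0; first by rewrite big1// => k _; rewrite mxE eqxx.
have [k ck] : exists k, c 0 k != 0.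
  apply/existsP; apply: contraR c0; rewrite negb_exists => /forallP h.
  by apply/eqP/rowP => k; have := h k; rewrite negbK mxE => /eqP.
by rewrite (bigD1 k)//= (negbTE ck) mul0r.
Qed.

Lemma sum_expi_fejer (n : nat) (y : R) :
  (\sum_(s < n) expi (y * s%:R)) * (\sum_(t < n) expi (- (y * t%:R))) = ((fejer n y)%:C)%C.
Proof.
rewrite fejerE.
have -> : \sum_(s < n) expi (y * s%:R) =
    ((\sum_(s < n) cos (y * s%:R)) +i* (\sum_(s < n) sin (y * s%:R)))%C.
  by apply/eqP; rewrite eq_complex Re_sum Im_sum/= !eqxx.
have -> : \sum_(s < n) expi (- (y * s%:R)) =
    ((\sum_(s < n) cos (y * s%:R)) +i* - (\sum_(s < n) sin (y * s%:R)))%C.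
  apply/eqP; rewrite eq_complex Re_sum Im_sum/= -sumrN.
  by under eq_bigr do rewrite cosN; under [X in _ && (X == _)]eq_bigr do rewrite sinN; rewrite !eqxx.
by apply/eqP; rewrite eq_complex/=; apply/andP; split; apply/eqP; ring.
Qed.

(** Each kernel is an exponential sum times its conjugate; expanding the product over the
    coordinates turns the choices of s and t into lattice points a and b. *)
Lemma sum_expi_lattice (d n : nat) (x : 'rV[R]_d) :
  \sum_(a : {ffun 'I_d -> 'I_n}) \sum_(b : {ffun 'I_d -> 'I_n})
    expi (\sum_k x 0 k * ((lattice_point a - lattice_point b) 0 k)%:~R)
  = ((\prod_k fejer n (x 0 k))%:C)%C.
Proof.
rewrite rmorph_prod (eq_bigr _ (fun k _ => esym (sum_expi_fejer n (x 0 k)))).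
rewrite big_split/= !bigA_distr_bigA big_distrl; apply: eq_bigr => a _.
rewrite big_distrr; apply: eq_bigr => b _ /=.
rewrite -!expi_sum -expiD -big_split/=; congr expi; apply: eq_bigr => k _.
by rewrite !mxE rmorphB/= mulrBr.
Qed.

(* The bound on J excludes aliasing: the frequency j + a - b is smaller than the
   number of grid points, so it averages to 0 unless j = b - a. *)
Lemma structure_partial_grid (d n p : nat) (K : 'rV[int]_d -> R)
    (J : {fset 'rV[int]_d}) :
  (forall a b : {ffun 'I_d -> 'I_n}, lattice_point b - lattice_point a \in J) ->
  (forall j k, j \in J -> (`|(j 0 k)%R| + n <= (n * p).*2)%N) ->
  \sum_(g : {ffun 'I_d -> grid n p})
     structure_partial K J (gridvector g) * \prod_k fejer n (gridvector g 0 k)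
  = (n * p).*2%:R ^+ d * \sum_(a : {ffun 'I_d -> 'I_n}) \sum_(b : {ffun 'I_d -> 'I_n})
      K (lattice_point b - lattice_point a).
Proof.
move=> Jbox Jnp.
pose e (x : 'rV[R]_d) (j : 'rV[int]_d) : R[i] := expi (\sum_k x 0 k * (j 0 k)%:~R).
have eD x i j : e x (i + j) = e x i * e x j.
  rewrite -expiD -big_split; congr expi; apply: eq_bigr => k _.
  by rewrite mxE rmorphD mulrDr.
(* The partial sum and the kernels are expanded into exponentials, with the sum over the grid
   innermost so that orthogonality applies to it. *)
transitivity (complex.Re (\sum_(j <- J) \sum_(a : {ffun 'I_d -> 'I_n})
    \sum_(b : {ffun 'I_d -> 'I_n}) \sum_(g : {ffun 'I_d -> grid n p})
    ((K j)%:C)%C * e (gridvector g) (j + (lattice_point a - lattice_point b)))).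
  symmetry.
  under eq_bigr do under eq_bigr do rewrite exchange_big/=.
  under eq_bigr do rewrite exchange_big/=.
  rewrite exchange_big/= Re_sum; apply: eq_bigr => g _.
  rewrite Re_sum /structure_partial big_distrl/=; apply: eq_bigr => j _.
  under eq_bigr do under eq_bigr do rewrite eD mulrA.
  under eq_bigr do rewrite -big_distrr/=.
  rewrite -big_distrr/= sum_expi_lattice /= !mulr0 !mul0r !subr0 ; ring.
rewrite Re_sum.
under eq_bigr => j _ do rewrite Re_sum; under eq_bigr => j _ do under eq_bigr => a _ do rewrite Re_sum.
rewrite exchange_big/= mulr_sumr; apply: eq_bigr => a _.
rewrite exchange_big/= mulr_sumr; apply: eq_bigr => b _.
rewrite (big_rem (lattice_point b - lattice_point a)) ?Jbox//= [X in _ + X](_ : _ = 0) ?addr0; last first.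
  rewrite big_seq big1// => j; rewrite mem_rem_uniq ?fset_uniq// inE => /andP[jba jJ].
  rewrite -big_distrr/= sum_expi_gridvector; last first.
    move=> k; have := Jnp j k jJ; rewrite !mxE.
    have := ltn_ord (a k); have := ltn_ord (b k).
    by move: (nat_of_ord _) (nat_of_ord _) (j 0 k) (n * p).*2; lia.
  by rewrite -opprB addr_eq0 opprK (negbTE jba) mul0r mulr0.
rewrite -big_distrr/= sum_expi_gridvector; last first.
  move=> k; rewrite addrA subrK subrr mxE absz0.
  have := ltn_ord (a k); have := Jnp _ k (Jbox a b); lia.
rewrite addrA subrK subrr eqxx mul1r.
rewrite (_ : _ ^+ d = ((n * p).*2%:R ^+ d)%:C%C); last first.
  by rewrite rmorphXn/= rmorph_nat.
by rewrite /= mulr0 subr0 mulrC.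
Qed.

End grid.

Arguments midpoint {R} n p q r.
Arguments gridpoint {R n p} g.
Arguments gridvector {R d n p} g.

(** * One-dimensional averages *)

Section one_dimension.
Variable R : realType.
Implicit Types (a L x : R) (n p q : nat).

(** * Powers, logarithms and partial sums of the zeta series *)

Lemma gt0_powRD x (r s : R) : 0 < x -> x `^ (r + s) = x `^ r * x `^ s.
Proof. by move=> x0; rewrite powRD// (gt_eqF x0) implybT. Qed.

Lemma powR_sub2 a x : 0 < x -> x `^ (a - 2) = x `^ a / x ^+ 2.
Proof. by move=> x0; rewrite gt0_powRD// powRN powR_mulrn// ltW. Qed.

Lemma ler_powRN a x y : a <= 0 -> 0 < x -> x <= y -> y `^ a <= x `^ a.
Proof.
move=> a0 x0 xy; have y0 := lt_le_trans x0 xy.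
rewrite -(opprK a) !(powRN _ (- a)) lef_pV2 ?posrE ?powR_gt0//.
by rewrite ge0_ler_powR ?oppr_ge0// nnegrE ltW.
Qed.

(** A partial sum of the series for zeta (2 - a); its term of index q is the contribution of block q
    of the grid, up to scaling. *)
Definition zeta_sum a n : R := \sum_(q < n) q.+1%:R `^ (a - 2).

Lemma ln_succ_ge n : n.+2%:R^-1 <= ln n.+2%:R - ln n.+1%:R :> R.
Proof.
rewrite -lerN2 opprB -ln_div ?posrE// [leRHS](_ : _ = - n.+2%:R^-1)//.
have -> : n.+1%:R / n.+2%:R = 1 + - n.+2%:R^-1 :> R.
  rewrite (_ : n.+1%:R = n.+2%:R - 1); last by rewrite -(natr1 n.+1) addrK.
  by rewrite mulrBl divff// mul1r.
apply: le_ln1Dx; rewrite ltrN2 invf_lt1// ltr1n//.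
Qed.

Lemma ln_succ_le n : ln n.+2%:R - ln n.+1%:R <= n.+1%:R^-1 :> R.
Proof.
rewrite -ln_div ?posrE//.
have -> : n.+2%:R / n.+1%:R = 1 + n.+1%:R^-1 :> R.
  by rewrite -(natr1 n.+1) mulrDl divff// mul1r.
by apply: le_ln1Dx; rewrite (lt_trans (ltrN10 _))// invr_gt0.
Qed.

(** A discrete form of the derivative of x^(a - 1). The ratio of the two powers is e^((1 - a) (ln y
    - ln x)), which 1 + u <= e^u and [ln_succ_ge] bound below by 1 + (1 - a) / y. *)
Lemma powR_step a n : a < 1 ->
  (1 - a) * n.+2%:R `^ (a - 2) <= n.+1%:R `^ (a - 1) - n.+2%:R `^ (a - 1) :> R.
Proof.
move=> a1; set y : R := n.+2%:R; set x : R := n.+1%:R.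
have y0 : 0 < y by rewrite ltr0n.
have x0 : 0 < x by rewrite ltr0n.
have xE : x `^ (a - 1) = y `^ (a - 1) * expR ((1 - a) * (ln y - ln x)).
  rewrite /powR !gt_eqF// -expRD; congr expR; ring.
have yE : y `^ (a - 2) = y `^ (a - 1) * y^-1.
  by rewrite -powR_inv1 ?ltW// -gt0_powRD//; congr (_ `^ _); ring.
have e : 1 + (1 - a) * y^-1 <= expR ((1 - a) * (ln y - ln x)).
  apply: le_trans (expR_ge1Dx _); rewrite lerD2l ler_wpM2l ?subr_ge0 ?(ltW a1)//.
  exact: ln_succ_ge.
have := ler_wpM2l (powR_ge0 y (a - 1)) e.
by rewrite mulrDr mulr1 xE yE lerBrDl [X in _ + X <= _]mulrCA.
Qed.

Lemma zeta_sum_ge1 a n : (0 < n)%N -> 1 <= zeta_sum a n.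
Proof.
by case: n => // n _; rewrite /zeta_sum big_ord_recl powR1 lerDl sumr_ge0.
Qed.

Lemma zeta_sum1E n : zeta_sum 1 n = \sum_(q < n) q.+1%:R^-1.
Proof.
apply: eq_bigr => q _; rewrite (_ : 1 - 2 = -1) ?powR_inv1//; ring.
Qed.

Lemma zeta_sum1_ge n : ln n.+1%:R <= zeta_sum 1 n.
Proof.
rewrite zeta_sum1E; elim: n => [|n IH]; first by rewrite ln1 big_ord0.
rewrite big_ord_recr/=; apply: le_trans (lerD IH (ln_succ_le n)).
by rewrite addrC subrK.
Qed.

Lemma zeta_sum1_le n : zeta_sum 1 n.+1 <= 1 + ln n.+1%:R.
Proof.
rewrite zeta_sum1E; elim: n => [|n IH].
  by rewrite big_ord_recr big_ord0/= ln1 invr1; lra.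
rewrite big_ord_recr/=; apply: (le_trans (lerD IH (ln_succ_ge n))).
by rewrite -addrA [X in _ + X]addrC subrK.
Qed.

Lemma zeta_sum_le a n : a < 1 -> zeta_sum a n <= 1 + (1 - a)^-1.
Proof.
move=> a1; have s0 : 0 < 1 - a by rewrite subr_gt0.
(* The bound is strengthened by a term in n^(a - 1), so that [powR_step] telescopes in the
   induction. *)
suff : forall n, zeta_sum a n.+1 <= 1 + (1 - a)^-1 * (1 - n.+1%:R `^ (a - 1)).
  case: n => [_|n /(_ n)/le_trans]; last apply.
    by rewrite /zeta_sum big_ord0 addr_ge0// invr_ge0 ltW.
  by rewrite lerD2l ler_piMr ?invr_ge0 ?(ltW s0)// lerBlDr lerDl powR_ge0.
elim=> [|m IH].
  by rewrite /zeta_sum big_ord_recr big_ord0/= !powR1 subrr mulr0; lra.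
rewrite /zeta_sum big_ord_recr/= -/(zeta_sum a m.+1).
have := powR_step m a1; rewrite -ler_pdivlMl// => h.
apply: (le_trans (lerD IH h)); rewrite -addrA lerD2l -mulrDr.
by rewrite ler_wpM2l ?invr_ge0 ?(ltW s0)//; lra.
Qed.

(** The growth contributed by one coordinate; the product over all coordinates is the rate of the
    theorem. *)
Definition rate a L : R := (if a == 1 then ln L else 1) * L `^ (1 - a).

(** This serves to absorb additive constants into the main term: ln L is unbounded if a = 1, and
    L^(1 - a) is if a < 1. *)
Lemma rate_unbounded a A : a <= 1 -> exists L0, forall L, L0 < L -> A <= rate a L.
Proof.
rewrite le_eqVlt => /orP[/eqP ->|a1].
  exists (expR A) => L AL; rewrite /rate eqxx subrr powRr0 mulr1.
  have L0 : 0 < L := lt_trans (expR_gt0 _) AL.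
  by rewrite -ler_expR lnK ?posrE// ltW.
have s0 : 0 < 1 - a by rewrite subr_gt0.
pose A1 := Num.max A 1; have A10 : 0 <= A1 by rewrite le_max ler01 orbT.
exists (A1 `^ (1 - a)^-1) => L AL; rewrite /rate lt_eqF// mul1r.
rewrite (@le_trans _ _ A1)//; first by rewrite le_max lexx.
rewrite [leLHS](_ : _ = (A1 `^ (1 - a)^-1) `^ (1 - a)); last first.
  by rewrite -powRrM mulVf ?powRr1// lt0r_neq0.
by rewrite ge0_ler_powR ?nnegrE ?powR_ge0// ltW// (le_lt_trans (powR_ge0 _ _) AL).
Qed.

Lemma zeta_sum_upper a : 0 <= a <= 1 -> exists2 C : R, 0 < C &
  forall L, expR 1 < L ->
    (Num.truncn L).+1%:R `^ (1 - a) * zeta_sum a (Num.truncn L).+1 <= C * rate a L.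
Proof.
(* The 2 comes from floor L + 1 <= 2L. The 3 covers 1 + ln (2L) <= 2 + ln L <= 3 ln L when a = 1,
   where L > e gives ln L >= 1. *)
move=> /andP[a0 a1]; exists (2 * (3 + (if a == 1 then 0 else (1 - a)^-1))).
  rewrite mulr_gt0// ltr_wpDr//; case: ifP => // _.
  by rewrite invr_ge0 subr_ge0.
move=> L eL; have L1 : 1 < L by rewrite (le_lt_trans _ eL)// -[leLHS]expR0 ler_expR.
have L0 := lt_trans ltr01 L1.
have lnL : 1 <= ln L by rewrite -ler_expR lnK ?posrE// ltW.
set n := Num.truncn L.
have nL : n.+1%:R <= 2 * L.
  have /andP[h _] := truncn_itv (ltW L0); rewrite -natr1; lra.
have np : n.+1%:R `^ (1 - a) <= 2 * L `^ (1 - a).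
  apply: (@le_trans _ _ ((2 * L) `^ (1 - a))).
    by rewrite ge0_ler_powR ?subr_ge0 ?nnegrE// mulr_ge0// ltW.
  rewrite powRM ?(ltW L0)// ler_wpM2r ?powR_ge0//.
  by rewrite ler1_powR ?ler1n// lerBlDr lerDl.
have key : zeta_sum a n.+1 <=
    (3 + (if a == 1 then 0 else (1 - a)^-1)) * (if a == 1 then ln L else 1).
  have [->|aN1] := eqVneq a 1.
    apply: (le_trans (zeta_sum1_le _)); rewrite addr0.
    have : ln n.+1%:R <= ln (2 * L) by rewrite ler_ln ?posrE// mulr_gt0.
    rewrite lnM ?posrE//.
    have : ln (1 + 1) <= 1 :> R by apply: le_ln1Dx; lra.
    rewrite -[1 + 1]/2; lra.
  have a1' : a < 1 by rewrite lt_neqAle aN1.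
  by apply: (le_trans (zeta_sum_le _ a1')); rewrite mulr1 lerD2r; lra.
apply: le_trans (ler_pM _ _ np key) _; rewrite ?powR_ge0//.
  by rewrite (le_trans ler01)// zeta_sum_ge1.
by rewrite /rate le_eqVlt; apply/orP; left; apply/eqP; ring.
Qed.

Lemma zeta_sum_lower a (k : R) : 0 <= a <= 1 -> 0 < k -> exists L0 : R,
  forall L, L0 < L ->
    2^-1 * rate a L <=
    (Num.truncn L).+1%:R `^ (1 - a) * zeta_sum a (Num.truncn (k * (Num.truncn L).+1%:R)).
Proof.
move=> /andP[a0 a1] k0.
(* L > 1/k makes the sum nonempty; L > 1/k^2 gives ln (kL) >= (ln L) / 2, which is the case a =
   1. *)
exists (Num.max 1 (Num.max (k^-1) (k^-1 ^+ 2))) => L.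
rewrite !gt_max => /and3P[L1 kL k2L]; have L0 := lt_trans ltr01 L1.
set n := Num.truncn L; set Q := Num.truncn _.
have nL : L <= n.+1%:R by have /andP[_ /ltW] := truncn_itv (ltW L0).
have kL1 : k * L <= k * n.+1%:R by rewrite ler_pM2l.
have Q1 : k * n.+1%:R < Q.+1%:R by have /andP[] := truncn_itv (mulr_ge0 (ltW k0) (ler0n R n.+1)).
have np : L `^ (1 - a) <= n.+1%:R `^ (1 - a).
  by rewrite ge0_ler_powR ?subr_ge0 ?nnegrE ?(ltW L0).
have Qpos : (0 < Q)%N.
  rewrite /Q truncn_gt0 (le_trans _ kL1)//.
  by rewrite mulrC -ler_pdivrMr// mul1r ltW.
have key : 2^-1 * (if a == 1 then ln L else 1) <= zeta_sum a Q.
  have [->|aN1] := eqVneq a 1.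
    apply: le_trans (zeta_sum1_ge _).
    have : ln (k * L) <= ln Q.+1%:R.
      by rewrite ler_ln ?posrE ?mulr_gt0// (le_trans kL1)// ltW.
    rewrite lnM ?posrE//.
    have : ln (k^-1 ^+ 2) <= ln L by rewrite ler_ln ?posrE ?exprn_gt0 ?invr_gt0// ltW.
    rewrite lnXn ?invr_gt0// lnV ?posrE// mulr2n; lra.
  by apply: le_trans (zeta_sum_ge1 _ Qpos); rewrite mulr1 invf_le1// ler1n.
rewrite /rate mulrA mulrC ler_pM ?powR_ge0// mulr_ge0//.
by case: ifP => // _; rewrite ln_ge0 // ltW.
Qed.

(** * Grid averages of the Fejer kernel against powers *)

Lemma fejer_grid_upper : exists2 C : R, 0 < C & forall a n p,
  0 <= a <= 1 ->
  \sum_(g : grid n p) fejer n (gridpoint g : R) * `|gridpoint g| `^ a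
  <= C * (n * p).*2%:R * (n%:R `^ (1 - a) * zeta_sum a n).
Proof.
have [k k0 kP] := fejer_le_sqr R.
(* [pi] serves block 0, through pi^a <= pi, and [k] serves the other blocks. *)
exists (pi + k); first by rewrite addr_gt0 ?pi_gt0.
move=> a n p /andP[a0 a1].
have [->|n0] := posnP n.
  rewrite (sum_grid _ _ (fun x => fejer 0 x * `|x| `^ a)) big_ord0.
  by rewrite /zeta_sum big_ord0 !mulr0.
have nR : 0 < n%:R :> R by rewrite ltr0n.
have block (q : 'I_n) (r : 'I_p) : fejer n (midpoint n p q r) * midpoint n p q r `^ a
    <= (pi + k) * (n%:R `^ (2 - a) * q.+1%:R `^ (a - 2)).
  have /andP[xl xu] := @midpoint_bounds R n p q r.
  have x0 := @midpoint_gt0 R n p q r.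
  have xpi := @midpoint_le_pi R n p q r.
  set x := midpoint n p q r in xl xu x0 xpi *.
  (* Block 0 touches the origin, so F_n <= n^2 is used there; the other blocks use F_n <= k /
     x^2. *)
  have [q0|q0] := posnP q.
    rewrite q0 powR1 mulr1 mulr1 in xu *.
    have n2 : n%:R ^+ 2 = n%:R `^ (2 - a) * n%:R `^ a :> R.
      by rewrite -gt0_powRD// subrK powR_mulrn.
    apply: (@le_trans _ _ (n%:R ^+ 2 * (pi / n%:R) `^ a)).
      rewrite ler_pM ?fejer_ge0 ?powR_ge0 ?fejer_le//.
      apply: ge0_ler_powR => //; [exact: ltW| |exact: ltW].
      by rewrite nnegrE divr_ge0// pi_ge0.
    rewrite n2 powRM ?pi_ge0 ?invr_ge0//.
    rewrite -(powR_inv1 (ltW nR)) -powRrM mulN1r powRN.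
    rewrite -mulrA [X in _ * X <= _](_ : _ = pi `^ a); last first.
      by rewrite mulrC mulfVK ?gt_eqF ?powR_gt0.
    rewrite [leLHS]mulrC; apply: ler_wpM2r; first exact: powR_ge0.
    rewrite ler_wpDr ?(ltW k0)//.
    by rewrite ler1_powR// (le_trans _ (@pi_ge2 R))// ler1n.
  apply: (@le_trans _ _ (k * x `^ (a - 2))).
    rewrite powR_sub2// [leRHS]mulrCA [leLHS]mulrC ler_wpM2l ?powR_ge0//.
    by rewrite kP ?gt_eqF// ger0_norm// ltW.
  (* For q >= 1 the left end satisfies pi q >= 2q >= q + 1, and the exponent a - 2 is negative. *)
  rewrite (@le_trans _ _ (k * (q.+1%:R / n%:R) `^ (a - 2)))//.
    rewrite ler_pM2l// ler_powRN ?divr_gt0//; first by lra.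
    apply: le_trans xl; rewrite ler_wpM2r ?invr_ge0//.
    apply: (@le_trans _ _ (2 * q%:R)); last by rewrite ler_wpM2r ?pi_ge2.
    by rewrite -natrM ler_nat; lia.
  rewrite powRM ?invr_ge0// -(powR_inv1 (ltW nR)) -powRrM mulN1r opprB.
  rewrite [X in k * X]mulrC ler_wpM2r ?mulr_ge0 ?powR_ge0//.
  by rewrite lerDr pi_ge0.
rewrite (sum_grid _ _ (fun x => fejer n x * `|x| `^ a)).
apply: (@le_trans _ _ (\sum_(q < n) \sum_(r < p)
    2 * ((pi + k) * (n%:R `^ (2 - a) * q.+1%:R `^ (a - 2))))).
  apply: ler_sum => q _; apply: ler_sum => r _.
  rewrite fejerN normrN ger0_norm ?(ltW (midpoint_gt0 R _ _))//.
  by have := block q r; lra.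
under eq_bigr do rewrite sumr_const card_ord -(mulr_natl _ p).
rewrite /zeta_sum !mulr_sumr le_eqVlt; apply/orP; left; apply/eqP.
apply: eq_bigr => q _.
have -> : n%:R `^ (2 - a) = n%:R * n%:R `^ (1 - a) :> R.
  rewrite -[X in X * _](powRr1 (ltW nR)) -gt0_powRD//.
  by congr (_ `^ _); ring.
by rewrite -muln2 !natrM; ring.
Qed.

Lemma fejer_grid_lower (e : R) : 0 < e -> exists2 k : R, 0 < k & forall a n p,
  0 <= a <= 1 ->
  8^-1 * (n * p).*2%:R * (n%:R `^ (1 - a) * zeta_sum a (Num.truncn (k * n%:R)))
  <= \sum_(g : grid n p | `|gridpoint g : R| < e)
        fejer n (gridpoint g : R) * `|gridpoint g| `^ a.
Proof.
move=> e0; pose e1 := Num.min e 1.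
have e10 : 0 < e1 by rewrite lt_min e0 ltr01.
(* The points of the first Q blocks are below 4Q / n <= e1 <= e, and e1 <= 1 ensures Q <= n. *)
exists (e1 / 4); first by rewrite divr_gt0.
move=> a n p /andP[a0 a1]; set Q := Num.truncn _.
have [->|n0] := posnP n.
  rewrite mul0n mulr0 mul0r sumr_ge0// => g _.
  by rewrite mulr_ge0 ?fejer_ge0 ?powR_ge0.
have nR : 0 < n%:R :> R by rewrite ltr0n.
have QE : Q%:R <= e1 / 4 * n%:R by rewrite truncn_le mulr_ge0// divr_ge0// ltW.
have Qn : (Q <= n)%N.
  rewrite -(ler_nat R) (le_trans QE)// ler_piMl// ler_pdivrMr// mul1r.
  by rewrite (@le_trans _ _ 1) ?ler1n// ge_min lexx orbT.
have pi4 : pi <= 4 :> R by have := @pihalf_lt2 R; lra.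
(* On each block the cosines cancel, so 2 - 2 cos (n x) has mean exactly 2. *)
have block (q : 'I_n) : \sum_(r < p) (2 - 2 * cos (n%:R * midpoint n p q r)) = 2 * p%:R :> R.
  rewrite sumrB sumr_const card_ord.
  suff -> : \sum_(r < p) 2 * cos (n%:R * midpoint n p q r) = 0 :> R by rewrite subr0 mulr_natr.
  have [->|p0] := posnP p; first by rewrite big_ord0.
  have pR : p%:R != 0 :> R by rewrite pnatr_eq0 -lt0n.
  have s0 : sin (pi / p%:R / 2 : R) != 0.
    rewrite gt_eqF// sin_gt0_pi// !divr_gt0 ?pi_gt0 ?ltr0n//=.
    rewrite -mulrA gtr_pMr ?pi_gt0// -invfM invf_lt1 -natrM ?ltr1n ?ltr0n; lia.
  apply: (mulIf s0); rewrite mul0r -[RHS](subrr 0).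
  (* A block is a half period: the telescoped sum is sin ((q + 1) pi) - sin (q pi), and both terms
     vanish. *)
  rewrite -[X in X - _](sin_natpi _ q.+1) -[X in _ - X](sin_natpi _ q).
  have E m : m%:R * pi = (m * p)%:R * (pi / p%:R) :> R by rewrite natrM; field.
  rewrite !E mulSn addnC -sum_cos_telescope; congr (_ * _); apply: eq_bigr => r _.
  congr (2 * cos _); rewrite /midpoint -!muln2 -(natr1 ((q * p + r) * 2)) !natrM; field.
  by rewrite pR gt_eqF.
rewrite big_mkcond/=.
rewrite (sum_grid _ _ (fun x => if `|x| < e then fejer n x * `|x| `^ a else 0)).
(* Only the blocks q < Q are kept. There x^(a - 2) is replaced by its value at 4 (q + 1) / n, which
   lies beyond the block as pi <= 4; the outer 2 counts the signs. *)
apply: (@le_trans _ _ (\sum_(q < n | (q < Q)%N) \sum_(r < p)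
   2 * ((2 - 2 * cos (n%:R * midpoint n p q r)) * (4 * (q.+1%:R / n%:R)) `^ (a - 2)))); last first.
  rewrite big_mkcond; apply: ler_sum => q _; case: ifPn => qQ; last first.
    apply: sumr_ge0 => r _; apply: addr_ge0; case: ifP => // _;
      by rewrite mulr_ge0 ?fejer_ge0 ?powR_ge0.
  apply: ler_sum => r _; have /andP[_ xu] := @midpoint_bounds R n p q r.
  have x0 := @midpoint_gt0 R n p q r.
  set x := midpoint n p q r in xu x0 *.
  have xu4 : x < 4 * (q.+1%:R / n%:R).
    by rewrite (lt_le_trans xu)// -mulrA ler_wpM2r// divr_ge0.
  have xe : x < e.
    rewrite (lt_le_trans xu4)// (@le_trans _ _ e1)//; last by rewrite ge_min lexx.
    rewrite mulrA ler_pdivrMr// mulrC -ler_pdivlMr// mulrAC (le_trans _ QE)//.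
    by rewrite ler_nat.
  rewrite fejerN normrN ger0_norm ?(ltW x0)// xe/=.
  suff : (2 - 2 * cos (n%:R * x)) * (4 * (q.+1%:R / n%:R)) `^ (a - 2) <= fejer n x * x `^ a.
    by move=> h; rewrite -mulr2n -[leRHS]mulr_natl ler_wpM2l.
  apply: (@le_trans _ _ ((2 - 2 * cos (n%:R * x)) * x `^ (a - 2))).
    apply: ler_wpM2l; first by have := cos_le1 (n%:R * x); lra.
    by rewrite ler_powRN ?(ltW xu4)//; lra.
  rewrite powR_sub2// mulrCA mulrC ler_wpM2r ?powR_ge0//.
  by rewrite fejer_ge_sqr// gt_eqF.
under eq_bigr => q _ do rewrite -mulr_sumr -mulr_suml block.
rewrite /zeta_sum (big_ord_widen _ (fun q => q.+1%:R `^ (a - 2) : R) Qn) !mulr_sumr.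
apply: ler_sum => q _; rewrite powRM// ?divr_ge0// (powRM _ (ler0n R q.+1)) ?invr_ge0//.
rewrite -(powR_inv1 (ltW nR)) -powRrM mulN1r opprB.
have -> : n%:R `^ (2 - a) = n%:R * n%:R `^ (1 - a) :> R.
  rewrite -[X in X * _](powRr1 (ltW nR)) -gt0_powRD//.
  by congr (_ `^ _); ring.
(* The two signs and the mean 2 give a factor 4p per block, and 4p / 16 is 8^-1 times its 2p
   points. *)
have f4 : 16^-1 <= 4 `^ (a - 2) :> R.
  rewrite powR_sub2// -[leLHS]mul1r (_ : 4 ^+ 2 = 16); last by ring.
  by rewrite ler_wpM2r// -[leLHS](powRr0 4) ler_powR// ler1n.
have f0 : 0 <= p%:R * n%:R * n%:R `^ (1 - a) * q.+1%:R `^ (a - 2) :> R.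
  by rewrite !mulr_ge0 ?powR_ge0.
have := ler_wpM2r f0 f4.
by rewrite -muln2 !natrM; lra.
Qed.

Lemma fejer_rate_upper a : 0 <= a <= 1 -> exists2 C : R, 0 < C & forall L n p,
  expR 1 < L -> n = (Num.truncn L).+1 ->
  \sum_(g : grid n p) fejer n (gridpoint g : R) * `|gridpoint g| `^ a
  <= C * (n * p).*2%:R * rate a L.
Proof.
move=> a01; have [C C0 CP] := fejer_grid_upper.
have [D D0 DP] := zeta_sum_upper a01.
exists (C * D); first exact: mulr_gt0.
move=> L n p eL nL; apply: (le_trans (CP a n p a01)).
rewrite [leRHS](_ : _ = C * (n * p).*2%:R * (D * rate a L)); last by ring.
by apply: ler_wpM2l; [rewrite mulr_ge0// ltW|rewrite nL DP].
Qed.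

(** The constant is 8^-1 from [fejer_grid_lower] times 2^-1 from [zeta_sum_lower]. The threshold is
    fixed before [p], whose later choice depends on L. *)
Lemma fejer_rate_lower a (e : R) : 0 <= a <= 1 -> 0 < e ->
  exists L0 : R, forall L, L0 < L -> forall n p, n = (Num.truncn L).+1 ->
  16^-1 * (n * p).*2%:R * rate a L
  <= \sum_(g : grid n p | `|gridpoint g : R| < e)
        fejer n (gridpoint g : R) * `|gridpoint g| `^ a.
Proof.
move=> a01 e0; have [k k0 kP] := fejer_grid_lower e0.
have [L0 LP] := zeta_sum_lower a01 k0.
exists L0 => L /LP + n p nL; rewrite -nL => rL; apply: le_trans (kP a n p a01).
have := ler_wpM2l (_ : 0 <= 8^-1 * (n * p).*2%:R :> R) rL.
rewrite mulr_ge0 ?invr_ge0// => /(_ isT); apply: le_trans.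
by rewrite le_eqVlt; apply/orP; left; apply/eqP; field.
Qed.

End one_dimension.

(** * Higher dimensions *)

Lemma card_grid (n p : nat) : #|grid n p| = (n * p).*2.
Proof. by rewrite !card_prod card_bool !card_ord mul2n. Qed.

Lemma prod_fejer_le (R : realType) (d n : nat) (x : 'rV[R]_d) :
  `|\prod_k fejer n (x 0 k)| <= (n%:R ^+ 2) ^+ d.
Proof.
rewrite normr_prod -[d in leRHS]card_ord -prodr_const.
by apply: ler_prod => k _; rewrite normr_ge0 ger0_norm ?fejer_ge0 ?fejer_le.
Qed.

(** K is truncated to a finite [J] containing all differences b - a, with uniform error at most
    n^(-2d). The product of kernels is at most n^(2d), so each grid point contributes an error at
    most 1. *)
Lemma variance_sum_grid (R : realType) (d n : nat) (K : 'rV[int]_d -> R) :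
  esum.summable [set: 'rV[int]_d] (fun j => (K j)%:E) -> (0 < n)%N ->
  exists2 p : nat, (0 < p)%N &
  `|\sum_(g : {ffun 'I_d -> grid n p})
       structure_function K (gridvector g) * \prod_k fejer n (gridvector g 0 k)
    - (n * p).*2%:R ^+ d * \sum_(a : {ffun 'I_d -> 'I_n}) \sum_(b : {ffun 'I_d -> 'I_n})
        K (lattice_point b - lattice_point a)| <= (n * p).*2%:R ^+ d.
Proof.
move=> sK n0; pose N2 : R := (n%:R ^+ 2) ^+ d.
have N20 : 0 < N2 by rewrite !exprn_gt0// ltr0n.
have N2V0 : 0 < N2^-1 by rewrite invr_gt0.
have [J0 J0P] := structure_function_approx sK N2V0.
pose D := [seq lattice_point ab.2 - lattice_point ab.1 |
            ab : {ffun 'I_d -> 'I_n} * {ffun 'I_d -> 'I_n}].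
pose J := (J0 `|` [fset x in D])%fset.
(* This exceeds every coordinate of every j in [J], which rules out aliasing. *)
pose p := (\sum_(j <- J) \sum_k `|(j 0%R k)%R| + 1)%N.
have p0 : (0 < p)%N by rewrite /p addn1.
exists p => //.
have Jbox (a b : {ffun 'I_d -> 'I_n}) : lattice_point b - lattice_point a \in J.
  by rewrite !inE; apply/orP; right; apply/mapP; exists (a, b); rewrite ?mem_enum.
have Jnp (j : 'rV[int]_d) k : j \in J -> (`|(j 0%R k)%R| + n <= (n * p).*2)%N.
  move=> jJ; have : (`|(j 0%R k)%R| < p)%N.
    by rewrite /p addn1 ltnS (big_rem j)//= (bigD1 k)//= -addnA leq_addr.
  by move: n0 p0; move: `|_|%N; nia.
rewrite -(structure_partial_grid K Jbox Jnp).
rewrite -sumrB (le_trans (ler_norm_sum _ _ _))//.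
apply: (@le_trans _ _ (\sum_(g : {ffun 'I_d -> grid n p}) 1)); last first.
  by rewrite sumr_const card_ffun card_grid card_ord natrX.
apply: ler_sum => g _; rewrite -mulrBl normrM.
apply: (@le_trans _ _ (N2^-1 * N2)); last by rewrite mulVf// lt0r_neq0.
by apply: ler_pM => //; [exact/J0P/fsubsetUl|exact: prod_fejer_le].
Qed.

Lemma gridvector_cube (R : realType) (d n p : nat) (g : {ffun 'I_d -> grid n p}) :
  cube (- pi) pi (gridvector g : 'rV[R]_d).
Proof.
by move=> k; rewrite -ler_norml mxE norm_gridpoint midpoint_le_pi.
Qed.

Lemma gridvector_neq0 (R : realType) (d n p : nat) (g : {ffun 'I_d -> grid n p}) k :
  (gridvector g : 'rV[R]_d) 0 k != 0.
Proof. by rewrite mxE -normr_eq0 norm_gridpoint gt_eqF// midpoint_gt0. Qed.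

(** * Bounds on the structure function from C1 *)

Section power_behaviour.
Context {R : realType} {d : nat}.
Variables (S : 'rV[R]_d -> R) (alpha : 'I_d -> R) (B : R).
Hypothesis alpha01 : forall k, 0 <= alpha k <= 1.
Hypothesis S_bounded : forall x, `|S x| <= B.
Hypothesis S_power : power_behaviour S alpha.

(* Away from the axes the factors |x_k|^(alpha k) are bounded below, so C1 and
   boundedness of S give a single upper bound on the whole cube. *)
Lemma power_upper : exists2 C : R, 0 < C &
  forall x, cube (- pi) pi x -> S x <= C * \prod_k `|x 0 k| `^ alpha k.
Proof.
have [delta [c1 [c2 [delta0 c10 c20 SP]]]] := S_power.
have B0 : 0 <= B by rewrite (le_trans _ (S_bounded 0)).
(* If |x_k| >= delta then D |x_k| >= 1, so D |x_k|^a >= (D |x_k|)^a >= 1: each missing factor costs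
   at most one D. *)
pose D := Num.max 1 delta^-1; have D1 : 1 <= D by rewrite le_max lexx.
have D0 : 0 < D := lt_le_trans ltr01 D1.
exists ((c2 + B) * D ^+ d); first by rewrite mulr_gt0 ?exprn_gt0 ?ltr_wpDr.
move=> x xpi; pose I := [set k | `|x 0 k| < delta]%SET.
have IP i : `|x 0 i| < delta <-> i \in I by rewrite inE.
have prodI : \prod_(i in I) `|x 0 i| `^ alpha i <= D ^+ d * \prod_k `|x 0 k| `^ alpha k.
  rewrite -[d in D ^+ d]card_ord -prodr_const -big_split/= big_mkcond/=.
  apply: ler_prod => k _; case: ifPn => kI.
    by rewrite powR_ge0/= ler_peMl ?powR_ge0.
  rewrite ler01/=.
  have xk : delta <= `|x 0 k| by move: kI; rewrite inE -leNgt.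
  have Dx : 1 <= D * `|x 0 k|.
    rewrite -[leLHS](mulVf (lt0r_neq0 delta0)).
    by rewrite ler_pM ?invr_ge0 ?(ltW delta0)// le_max lexx orbT.
  have /andP[a0 a1] := alpha01 k.
  apply: (@le_trans _ _ ((D * `|x 0 k|) `^ alpha k)).
    by rewrite -[leLHS](powRr0 (D * `|x 0 k|)) ler_powR.
  by rewrite powRM ?(ltW D0)// ler_wpM2r ?powR_ge0// ler1_powR.
rewrite -mulrA (@le_trans _ _ ((c2 + B) * \prod_(i in I) `|x 0 i| `^ alpha i))//; last first.
  by rewrite ler_wpM2l// addr_ge0// ltW.
(* C1 does not cover the empty index set; there the bound [B] is used. *)
have [I0|I0] := eqVneq I finset.set0.
  by rewrite I0 big_set0 mulr1 (le_trans (ler_norm _))// (le_trans (S_bounded x))// lerDr ltW.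
have /andP[_ /le_trans] := SP I I0 x xpi IP; apply.
by rewrite ler_wpM2r ?prodr_ge0// lerDl.
Qed.

(** The truncated product is nonzero only if all coordinates are below delta, where C1 applies with
    the full index set. If some but not all are, C1 gives S >= 0. If none is, S and the kernels are
    bounded, uniformly in n, which fixes the constant C. *)
Lemma power_lower : (0 < d)%N -> exists c e C : R, [/\ 0 < c, 0 < e, 0 <= C &
  forall n x, cube (- pi) pi x -> (forall k, x 0 k != 0) ->
    c * \prod_k (if `|x 0 k| < e then fejer n (x 0 k) * `|x 0 k| `^ alpha k else 0)
      - C <= S x * \prod_k fejer n (x 0 k)].
Proof.
move=> d0; have [delta [c1 [c2 [delta0 c10 c20 SP]]]] := S_power.
have B0 : 0 <= B by rewrite (le_trans _ (S_bounded 0)).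
have [k k0 kP] := fejer_le_sqr R.
have C0 : 0 <= B * (k / delta ^+ 2) ^+ d.
  by rewrite mulr_ge0// exprn_ge0// divr_ge0 ?exprn_ge0// ltW.
exists c1, delta, (B * (k / delta ^+ 2) ^+ d); split=> // n x xpi xN0.
have F0 : 0 <= \prod_k fejer n (x 0 k) by rewrite prodr_ge0// => i _; exact: fejer_ge0.
pose I := [set k | `|x 0 k| < delta]%SET.
have IP i : `|x 0 i| < delta <-> i \in I by rewrite inE.
have [/forallP all_lt|] := boolP [forall k, `|x 0 k| < delta].
  have IT : I = [set: 'I_d]%SET by apply/setP => i; rewrite !inE all_lt.
  (* The full index set is nonempty because d > 0. *)
  have I0 : I != finset.set0 by rewrite IT -card_gt0 cardsT card_ord.
  have /andP[+ _] := SP I I0 x xpi IP.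
  rewrite IT (eq_bigl xpredT) => [h|i]; last by rewrite inE.
  under eq_bigr do rewrite all_lt.
  rewrite big_split/= lerBlDr (@le_trans _ _ (S x * \prod_k fejer n (x 0 k)))//.
    by rewrite mulrCA mulrC ler_wpM2r.
  by rewrite lerDl.
rewrite negb_forall => /existsP[i ilt].
rewrite (bigD1 i)//= (negbTE ilt) !(mul0r, mulr0) sub0r.
have [I0|I0] := eqVneq I finset.set0; last first.
  have /andP[+ _] := SP I I0 x xpi IP => h.
  rewrite (@le_trans _ _ 0) ?oppr_le0// mulr_ge0// (le_trans _ h)// mulr_ge0 ?(ltW c10)//.
  by rewrite prodr_ge0// => j _; exact: powR_ge0.
rewrite lerNl -mulNr (le_trans (ler_norm _))// normrM normrN ler_pM//.
rewrite ger0_norm// -[d in leRHS]card_ord -prodr_const.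
apply: ler_prod => j _; rewrite fejer_ge0/=.
have xj : delta <= `|x 0 j|.
  by rewrite leNgt; apply/negP => /IP; rewrite I0 inE.
rewrite (le_trans (kP n _ _ (xN0 j)))//; first by rewrite ler_norml.
rewrite ler_pM2l// lef_pV2 ?posrE ?exprn_even_gt0 ?xN0 ?(gt_eqF delta0)//.
by rewrite -(real_normK (num_real (x 0 j))) lerXn2r ?nnegrE// ltW.
Qed.

End power_behaviour.

(** * Assembly of the bounds *)

Lemma eventually_forall (R : realType) (d : nat) (Pr : 'I_d -> R -> Prop) :
  (forall k, exists L0, forall L, L0 < L -> Pr k L) ->
  exists L0, forall L, L0 < L -> forall k, Pr k L.
Proof.
(* The sum of the absolute values dominates each of the finitely many thresholds. *)
move=> /choice[L0 LP]; exists (\sum_k `|L0 k|) => L lL k.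
apply: LP; apply: le_lt_trans lL; rewrite (bigD1 k)//=.
by rewrite (le_trans (ler_norm _))// lerDl sumr_ge0.
Qed.

Lemma prod_rate (R : realType) (d : nat) (alpha : 'I_d -> R) (L : R) : 0 < L ->
  \prod_k rate (alpha k) L =
  ln L ^+ #|[set k | alpha k == 1]%SET| * L `^ (d%:R - \sum_k alpha k).
Proof.
move=> L0; rewrite big_split/=; congr (_ * _).
  rewrite -big_mkcond/= prodr_const; congr (_ ^+ _).
  by apply: eq_card => k; rewrite !inE.
have -> : d%:R - \sum_k alpha k = \sum_k (1 - alpha k).
  by rewrite sumrB sumr_const card_ord.
elim/big_ind2 : _ => //; first by rewrite powRr0.
by move=> u v w z -> ->; rewrite gt0_powRD.
Qed.

Theorem theorem4 (R : realType) (disp : measure_display)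
  (T : measurableType disp) (P : probability T R)
  (d : nat) (hd : (1 <= d)%N)
  (X : 'rV[int]_d -> {RV P >-> R}) (K : 'rV[int]_d -> R)
  (alpha : 'I_d -> R)
  (mean_zero : forall i, ('E_P[X i] = 0)%E)
  (variance_one : forall i, ('V_P[X i] = 1)%E)
  (invariant : translation_invariant P X)
  (covarianceK : forall i j, ('E_P[X i \* X j] = (K (i - j))%:E)%E)
  (summableK : summable [set: 'rV[int]_d] (fun j => (K j)%:E))
  (alpha01 : forall k, 0 <= alpha k <= 1)
  (C1 : power_behaviour (structure_function K) alpha)
  (C2 : off_axes_integrable (structure_function K)) :
  let tau := #|[set k | alpha k == 1]%SET| in
  let m := \sum_k alpha k in
  Theta (fun L => ('V_P[Q (cube 0 L) X])%E)
        (fun L => ln L ^+ tau * L `^ (d%:R - m)).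
Proof.
move=> tau m.
have [B BP] := structure_function_bounded summableK.
have [Cu Cu0 upper] := power_upper alpha01 BP C1.
have [c [e [Cl [c0 e0 Cl0 lower]]]] := power_lower BP C1 hd.
have /choice[D DP] : forall k, exists D : R, 0 < D /\ forall L n p,
    expR 1 < L -> n = (Num.truncn L).+1 ->
    \sum_(g : grid n p) fejer n (gridpoint g : R) * `|gridpoint g| `^ alpha k
      <= D * (n * p).*2%:R * rate (alpha k) L.
  by move=> k; have [D D0 DP] := fejer_rate_upper (alpha01 k); exists D.
have [L1 L1P] := eventually_forall (fun k => fejer_rate_lower (alpha01 k) e0).
(* Beyond [L2] every rate is at least 1, so their product is at least any one of them. *)
have [L2 L2P] := eventually_forall (fun k =>
  rate_unbounded 1 (proj2 (andP (alpha01 k)))).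
pose k0 := Ordinal hd; pose c16 : R := 16^-1 ^+ d.
have c160 : 0 < c16 by rewrite exprn_gt0// invr_gt0.
have cc0 : 0 < c * c16 by rewrite mulr_gt0.
(* Beyond [L3] half of the lower main term is at least Cl + 1, the constant of [power_lower] plus
   the truncation error. *)
have [L3 L3P] := rate_unbounded (2 * (Cl + 1) / (c * c16)) (proj2 (andP (alpha01 k0))).
exists (c * c16 / 2), (Cu * (\prod_k D k) + 1), (Num.max (expR 1) (Num.max L1 (Num.max L2 L3))).
split; first by rewrite divr_gt0.
- rewrite ltr_wpDl// mulr_ge0 ?(ltW Cu0)// prodr_ge0// => k _.
  by rewrite ltW// (DP k).1.
- by rewrite lt_max expR_gt0.
move=> L; rewrite !gt_max => /and4P[eL L1L L2L L3L].
have L0 : 0 < L := lt_trans (expR_gt0 1) eL.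
rewrite /tau /m -prod_rate//.
rewrite (variance_Q_cube mean_zero variance_one covarianceK (ltW L0)).
set n := (Num.truncn L).+1; set V := \sum_a _; rewrite !lee_fin.
have [p p0] := variance_sum_grid summableK (ltn0Sn (Num.truncn L)).
(* [M ^+ d] is the number of grid points, so W equals M^d V up to an error M^d. *)
rewrite -/n -/V; set W := \sum_g _; set M : R := (n * p).*2%:R.
have M0 : 0 < M ^+ d.
  by rewrite exprn_gt0// ltr0n double_gt0 muln_gt0/=.
have rate1 k : 1 <= rate (alpha k) L := L2P L L2L k.
have rateA A : A <= rate (alpha k0) L -> A <= \prod_k rate (alpha k) L.
  move=> /le_trans; apply; rewrite (bigD1 k0)//= ler_peMr//.
    by rewrite (le_trans ler01).
  by elim/big_ind : _ => // u v; exact: mulr_ege1.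
set G := \prod_k _ in rateA *.
have G1 : 1 <= G by apply: rateA.
have G3 : 2 * (Cl + 1) / (c * c16) <= G by apply/rateA/L3P.
rewrite ler_norml => /andP[lW uW].
have Wu : W <= M ^+ d * (Cu * (\prod_k D k) * G).
  apply: (@le_trans _ _ (\sum_(g : {ffun 'I_d -> grid n p}) Cu * \prod_k
      (fejer n (gridpoint (g k) : R) * `|gridpoint (g k)| `^ alpha k))).
    apply: ler_sum => g _; rewrite big_split/= mulrCA [leLHS]mulrC.
    under eq_bigr do rewrite mxE.
    apply: ler_wpM2l; first by rewrite prodr_ge0// => k _; exact: fejer_ge0.
    apply: (le_trans (upper _ (gridvector_cube R g))).
    by under eq_bigr do rewrite mxE.
  (* The sum over grid vectors of a product over coordinates is the product of the one-dimensional
     sums. *)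
  rewrite -mulr_sumr -(bigA_distr_bigA (fun k (g : grid n p) =>
    fejer n (gridpoint g : R) * `|gridpoint g| `^ alpha k)) /=.
  rewrite [leRHS](_ : _ = Cu * \prod_k (D k * M * rate (alpha k) L)); last first.
    by rewrite 2!big_split/= prodr_const card_ord -/G; ring.
  apply: ler_wpM2l; first exact: ltW.
  apply: ler_prod => k _; rewrite (DP k).2// andbT sumr_ge0// => g _.
  by rewrite mulr_ge0 ?fejer_ge0 ?powR_ge0.
have Wl : M ^+ d * (c * c16 * G - Cl) <= W.
  apply: (@le_trans _ _ (\sum_(g : {ffun 'I_d -> grid n p}) (c * \prod_k
      (if `|gridpoint (g k) : R| < e then
       fejer n (gridpoint (g k) : R) * `|gridpoint (g k)| `^ alpha k else 0) - Cl))); last first.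
    apply: ler_sum => g _.
    have := lower n _ (gridvector_cube R g) (gridvector_neq0 R g).
    by under eq_bigr do rewrite mxE.
  rewrite sumrB sumr_const card_ffun card_grid card_ord -mulr_natl natrX -/M mulrBr lerD2r.
  rewrite -mulr_sumr -(bigA_distr_bigA (fun k (g : grid n p) =>
    if `|gridpoint g : R| < e then
    fejer n (gridpoint g : R) * `|gridpoint g| `^ alpha k else 0)) /=.
  rewrite [leLHS](_ : _ = c * \prod_k (16^-1 * M * rate (alpha k) L)); last first.
    by rewrite 2!big_split/= !prodr_const card_ord -/G -/c16; ring.
  apply: ler_wpM2l; first exact: ltW.
  apply: ler_prod => k _; rewrite -big_mkcond/= L1P// andbT.
  by rewrite mulr_ge0 ?(le_trans ler01 (rate1 k))// mulr_ge0// invr_ge0.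
(* After multiplication by M^d, the lower bound absorbs Cl + 1 into half of the main term, and the
   upper bound absorbs the error 1 through 1 <= G. *)
apply/andP; split; rewrite -(ler_pM2l M0).
  have h : Cl + 1 <= c * c16 / 2 * G.
    move: G3; rewrite ler_pdivrMr//; lra.
  have := ler_wpM2l (ltW M0) h; lra.
have := ler_wpM2l (ltW M0) G1; lra.
Qed.
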